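(* Let $\mathcal{A}$ be a unital algebra and let $\alpha=\{\alpha_g:\mathcal{D}_{g^{-1}}\to\mathcal{D}_g\ (g\in G)\}$ be a partial action of a group $G$ on $\mathcal{A}$. Then $\alpha$ admits an enveloping action $\beta$ if and only if each ideal $\mathcal{D}_g$ $(g\in G)$ is a unital algebra. Moreover, $\beta$, if it exists, is unique up to equivalence.
   Context: Let $K$ be a field. An algebra means an associative $K$-algebra, not necessarily unital; ideals are two-sided. The zero ideal is regarded as a unital algebra (so ''$\mathcal{D}_g$ is a unital algebra'' means $\mathcal{D}_g=1_g\mathcal{A}$ for some, possibly zero, central idempotent $1_g$ of $\mathcal{A}$). A partial action $\alpha$ of a group $G$ (with identity $1$) on an algebra $\mathcal{A}$ is a collection of ideals $\mathcal{D}_g$ of $\mathcal{A}$ $(g\in G)$ and algebra isomorphisms $\alpha_g:\mathcal{D}_{g^{-1}}\to\mathcal{D}_g$ such that: (i) $\mathcal{D}_1=\mathcal{A}$ and $\alpha_1$ is the identity map of $\mathcal{A}$; (ii) $\mathcal{D}_{(gh)^{-1}}\supseteq \alpha_h^{-1}(\mathcal{D}_h\cap\mathcal{D}_{g^{-1}})$ for all $g,h\in G$; (iii) $\alpha_g\circ\alpha_h(x)=\alpha_{gh}(x)$ for each $x\in\alpha_h^{-1}(\mathcal{D}_h\cap\mathcal{D}_{g^{-1}})$. A (global) action of $G$ on $\mathcal{B}$ by algebra automorphisms is the special case in which every $\mathcal{D}_g$ is $\mathcal{B}$. Equivalence: partial actions $\{\alpha_g:\mathcal{D}_{g^{-1}}\to\mathcal{D}_g\}$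 of $G$ on $\mathcal{A}$ and $\{\alpha'_g:\mathcal{D}'_{g^{-1}}\to\mathcal{D}'_g\}$ of $G$ on $\mathcal{A}'$ are equivalent if there is an algebra isomorphism $\varphi:\mathcal{A}\to\mathcal{A}'$ such that for every $g\in G$: $\varphi(\mathcal{D}_g)=\mathcal{D}'_g$, and $\alpha'_g\circ\varphi(x)=\varphi\circ\alpha_g(x)$ for all $x\in\mathcal{D}_{g^{-1}}$. Enveloping action: an action $\beta$ of $G$ on an algebra $\mathcal{B}$ by automorphisms $\beta_g$ is an enveloping action for the partial action $\alpha$ of $G$ on $\mathcal{A}$ if there is an algebra isomorphism $\varphi$ of $\mathcal{A}$ onto an ideal of $\mathcal{B}$ such that for all $g\in G$: $\varphi(\mathcal{D}_g)=\varphi(\mathcal{A})\cap\beta_g(\varphi(\mathcal{A}))$; $\varphi\circ\alpha_g(x)=\beta_g\circ\varphi(x)$ for each $x\in\mathcal{D}_{g^{-1}}$; and $\mathcal{B}$ is generated as an algebra by $\bigcup_{g\in G}\beta_g(\varphi(\mathcal{A}))$. *)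

(* Defs.v *)
From HB Require Import structures.
From mathcomp Require Import all_boot all_order all_algebra.
From mathcomp Require Import boolp classical_sets functions.

Set Implicit Arguments.
Unset Strict Implicit.
Unset Printing Implicit Defensive.

Import GRing.Theory.

Local Open Scope classical_set_scope.
Local Open Scope ring_scope.

(* The product of a non-unital algebra is the semigroup operation [(x * y)%g],
   so that associativity is [mulgA]; MathComp's own algebra types all have a
   unit. *)
HB.mixin Record Lmodule_Semigroup_isNuAlgebra (K : fieldType) A
    of GRing.Lmodule K A & Semigroup A := {
  mulgDZl : forall (a : K) (x y z : A),
    ((a *: x + y) * z)%g = a *: (x * z)%g + (y * z)%g;
  mulgDZr : forall (a : K) (x y z : A),
    (z * (a *: x + y))%g = a *: (z * x)%g + (z * y)%g
}.

#[short(type="nuAlgType")]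
HB.structure Definition NuAlgebra (K : fieldType) :=
  {A of GRing.Lmodule K A & Semigroup A & Lmodule_Semigroup_isNuAlgebra K A}.

Section Subsets.
Context (K : fieldType) (A : nuAlgType K).
Implicit Types (X I : set A).

Definition subspace X : Prop :=
  X 0 /\ (forall (a : K) x y, X x -> X y -> X (a *: x + y)).

Definition subalgebra X : Prop :=
  subspace X /\ (forall x y, X x -> X y -> X (x * y)%g).

Definition ideal I : Prop :=
  subspace I /\ (forall a x, I x -> I (a * x)%g /\ I (x * a)%g).

(* The unit [e] may be 0, in which case [X] is the zero algebra. *)
Definition unital X : Prop :=
  exists2 e, X e & forall x, X x -> (e * x)%g = x /\ (x * e)%g = x.

Lemma unital_idealP I : ideal I ->
  unital I <-> exists e, [/\ (e * e)%g = e,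
                            forall x, (e * x)%g = (x * e)%g
                          & I = range (fun x => (e * x)%g)].
Proof.
move=> [_ II]; split=> [[e Ie eP]|[e [ee ec ->]]].
- exists e; split.
  + by have [] := eP e Ie.
  + move=> x; have [_ Iex] := II x e Ie; have [Ixe _] := II x e Ie.
    have [_ <-] := eP _ Iex; have [<- _] := eP _ Ixe.
    by rewrite mulgA.
  + apply/seteqP; split=> [x Ix|_ [x _ <-]]; last by have [] := II x e Ie.
    by exists x => //; have [] := eP x Ix.
- exists e; first by exists e.
  by move=> _ [x _ <-]; rewrite -ec mulgA ee.
Qed.

End Subsets.

Definition alg_iso (K : fieldType) (A B : nuAlgType K)
    (X : set A) (Y : set B) (f : A -> B) : Prop :=
  [/\ set_bij X Y f,
      forall (a : K) x y, X x -> X y -> f (a *: x + y) = a *: f x + f y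
    & forall x y, X x -> X y -> f (x * y)%g = (f x * f y)%g].

(* [pact g] is a total function of which only the restriction to
   [pdom g^-1] is meaningful. *)
Record partial_action (G : groupType) (K : fieldType) (A : nuAlgType K) :=
  PartialAction {
  pdom : G -> set A;
  pact : G -> A -> A;
  pdom_ideal : forall g, ideal (pdom g);
  pact_iso : forall g, alg_iso (pdom g^-1%g) (pdom g) (pact g);
  pdom1 : pdom 1%g = [set: A];
  pact1 : forall x, pact 1%g x = x;
  pdomM : forall g h,
    pdom h^-1%g `&` pact h @^-1` (pdom h `&` pdom g^-1%g)
      `<=` pdom ((g * h)^-1)%g;
  pactM : forall g h x,
    (pdom h^-1%g `&` pact h @^-1` (pdom h `&` pdom g^-1%g)) x ->
    pact g (pact h x) = pact (g * h)%g x
}.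

Section PartialActions.
Context (G : groupType) (K : fieldType).

Definition is_global (B : nuAlgType K) (beta : partial_action G B) : Prop :=
  forall g, pdom beta g = [set: B].

Definition equivalent (A A' : nuAlgType K)
    (alpha : partial_action G A) (alpha' : partial_action G A') : Prop :=
  exists phi : A -> A',
    alg_iso [set: A] [set: A'] phi /\
    forall g, phi @` pdom alpha g = pdom alpha' g /\
      forall x, pdom alpha g^-1%g x ->
        pact alpha' g (phi x) = phi (pact alpha g x).

Definition enveloping (A B : nuAlgType K)
    (alpha : partial_action G A) (beta : partial_action G B) : Prop :=
  is_global beta /\
  exists phi : A -> B,
    [/\ ideal (range phi) /\ alg_iso [set: A] (range phi) phi,
        forall g,
          phi @` pdom alpha g = range phi `&` pact beta g @` range phi,
        forall g x, pdom alpha g^-1%g x ->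
          phi (pact alpha g x) = pact beta g (phi x)
      & smallest (@subalgebra K B)
          (\bigcup_g (pact beta g @` range phi)) = [set: B]].

End PartialActions.

(* Main.v *)
(** The unit of [D g] is the product of the units of the two ideals
    [phi A] and [beta g (phi A)] of [B], which proves one direction.
    Conversely, write [1_g] for the unit of [D g].  Sending [a] to the function
    [h |-> alpha (h^-1) (a 1_h)] embeds [A] into the pointwise algebra of
    functions [G -> A], on which [G] acts by translation, and the translates
    of the image generate an enveloping action.  It is universal: given any
    enveloping action on [B], an element [b] is recorded by the function
    [h |-> phi^-1 (beta (h^-1) b * phi 1)], and no information is lost because
    an element of [B] killed by all [beta h (phi 1)] is zero.  Hence all
    enveloping actions are equivalent to this one. *)

Require Import Defs.
From HB Require Import structures.
From mathcomp Require Import all_boot all_order all_algebra.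
From mathcomp Require Import boolp classical_sets functions.

Set Implicit Arguments.
Unset Strict Implicit.
Unset Printing Implicit Defensive.

Import GRing.Theory.
Local Open Scope classical_set_scope.
Local Open Scope ring_scope.

(** * The pointwise algebra of functions into an algebra *)

Section PointwiseAlgebra.
Context (K : fieldType) (T : Type) (A : nuAlgType K).
Implicit Types f g h : T -> A.

Definition fct_mul f g : T -> A := fun t => (f t * g t)%g.

Fact fct_mulA : associative fct_mul.
Proof. by move=> f g h; apply/funext => t; exact: mulgA. Qed.

HB.instance Definition _ := isSemigroup.Build (T -> A) fct_mulA.

Fact fct_mulDZl (a : K) f g h :
  ((a *: f + g) * h)%g = a *: (f * h)%g + (g * h)%g.
Proof. by apply/funext => t; exact: mulgDZl. Qed.

Fact fct_mulDZr (a : K) f g h :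
  (h * (a *: f + g))%g = a *: (h * f)%g + (h * g)%g.
Proof. by apply/funext => t; exact: mulgDZr. Qed.

HB.instance Definition _ :=
  Lmodule_Semigroup_isNuAlgebra.Build K (T -> A) fct_mulDZl fct_mulDZr.

Lemma fct_mulE f g t : (f * g)%g t = (f t * g t)%g.
Proof. by []. Qed.

End PointwiseAlgebra.

(** * The subalgebra generated by a set, as an algebra in its own right *)

Section GeneratedSubalgebra.
Context (K : fieldType) (B : nuAlgType K) (X : set B).

(** Made boolean by classical reflection, so that a subtype can be carved out of it. *)
Definition gen_subalg : pred B :=
  fun x => `[< smallest (@subalgebra K B) X x >].

Lemma subalgebra_smallest : subalgebra (smallest (@subalgebra K B) X).
Proof.
split; [split=> [M [[[]]]|a x y Mx My M MP]|move=> x y Mx My M MP] => //.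
- have [[[_ +] _] _] := MP; apply; [exact: Mx|exact: My].
- have [[_ +] _] := MP; apply; [exact: Mx|exact: My].
Qed.

Fact gen_submod_closed : submod_closed gen_subalg.
Proof.
have [[S0 SD] _] := subalgebra_smallest.
split=> [|a x y /asboolP Sx /asboolP Sy]; apply/asboolP => //.
exact: SD.
Qed.

Fact gen_mul_closed : {in gen_subalg &, forall x y, (x * y)%g \in gen_subalg}.
Proof.
have [_ SM] := subalgebra_smallest.
by move=> x y /asboolP Sx /asboolP Sy; apply/asboolP; exact: SM.
Qed.

HB.instance Definition _ := GRing.isSubmodClosed.Build K B gen_subalg
  gen_submod_closed.
HB.instance Definition _ := isMulClosed.Build B gen_subalg gen_mul_closed.
Definition generated := {x : B | gen_subalg x}.
HB.instance Definition _ := SubChoice.on generated.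
HB.instance Definition _ := [SubChoice_isSubLmodule of generated by <:].
HB.instance Definition _ :=
  SubChoice_isSubSemigroup.Build B gen_subalg generated gen_mul_closed.

Fact generated_mulDZl (a : K) (x y z : generated) :
  ((a *: x + y) * z)%g = a *: (x * z)%g + (y * z)%g.
Proof. by apply/val_inj; exact: mulgDZl. Qed.

Fact generated_mulDZr (a : K) (x y z : generated) :
  (z * (a *: x + y))%g = a *: (z * x)%g + (z * y)%g.
Proof. by apply/val_inj; exact: mulgDZr. Qed.

HB.instance Definition _ := Lmodule_Semigroup_isNuAlgebra.Build K generated
  generated_mulDZl generated_mulDZr.

End GeneratedSubalgebra.

Lemma linear_comb0 (K : fieldType) (V W : lmodType K) (f : V -> W) :
  (forall (c : K) x y, f (c *: x + y) = c *: f x + f y) -> f 0 = 0.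
Proof.
by move=> fDZ; have := fDZ (-1) 0 0; rewrite scaler0 addr0 scaleN1r addNr.
Qed.

(** * Elementary identities in non-unital algebras *)

Section NuAlgebraTheory.
Context (K : fieldType) (A : nuAlgType K).
Implicit Types x y z e : A.

Lemma mulgDl x y z : ((x + y) * z)%g = (x * z)%g + (y * z)%g.
Proof. by rewrite -[x in LHS]scale1r mulgDZl scale1r. Qed.

Lemma mulgDr x y z : (z * (x + y))%g = (z * x)%g + (z * y)%g.
Proof. by rewrite -[x in LHS]scale1r mulgDZr scale1r. Qed.

Lemma mul0g z : (0 * z)%g = 0.
Proof. by have := mulgDl 0 0 z; rewrite addr0 -[LHS]add0r => /addIr. Qed.

Lemma mulg0 z : (z * 0)%g = 0.
Proof. by have := mulgDr 0 0 z; rewrite addr0 -[LHS]add0r => /addIr. Qed.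

Lemma mulNg x z : (- x * z)%g = - (x * z)%g.
Proof. by apply/eqP; rewrite -addr_eq0 -mulgDl addNr mul0g. Qed.

Lemma mulgN x z : (z * - x)%g = - (z * x)%g.
Proof. by apply/eqP; rewrite -addr_eq0 -mulgDr addNr mulg0. Qed.

(** The induction principle for an algebra generated by [X], used for every argument on generators
    below. *)
Lemma smallest_subalgebraP (X M : set A) :
  smallest (@subalgebra K A) X = [set: A] -> subalgebra M -> X `<=` M ->
  forall x, M x.
Proof.
move=> XT MA XM x; apply: (smallest_sub MA XM).
by rewrite XT.
Qed.

(** Both [e * x] and [x * e] lie in [I], hence both equal [e * x * e]. *)
Lemma ideal_unitC (I : set A) e x : ideal I -> I e ->
  (forall y, I y -> (e * y)%g = y /\ (y * e)%g = y) -> (e * x)%g = (x * e)%g.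
Proof.
move=> [_ II] Ie eP; have [Ixe Iex] := II x e Ie.
by have [<- _] := eP _ Ixe; have [_ <-] := eP _ Iex; rewrite mulgA.
Qed.

End NuAlgebraTheory.

(** * Isomorphisms, and equivalence as a symmetric and transitive relation *)

Section AlgIso.
Context (K : fieldType).

Lemma alg_isoT_inv (A B : nuAlgType K) (f : A -> B) :
  alg_iso [set: A] [set: B] f ->
  exists g, [/\ cancel f g, cancel g f & alg_iso [set: B] [set: A] g].
Proof.
move=> [+ fD fM]; rewrite setTT_bijective => -[g fK gK]; exists g.
split=> //; split.
- by rewrite setTT_bijective; exists f.
- by move=> a x y _ _; apply: (can_inj fK); rewrite fD ?gK.
- by move=> x y _ _; apply: (can_inj fK); rewrite fM ?gK.
Qed.

Lemma alg_iso_comp (A B C : nuAlgType K) (f : A -> B) (g : B -> C) :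
  alg_iso [set: A] [set: B] f -> alg_iso [set: B] [set: C] g ->
  alg_iso [set: A] [set: C] (g \o f).
Proof.
move=> [fb fD fM] [gb gD gM]; split.
- by rewrite setTT_bijective; apply: bij_comp; rewrite -setTT_bijective.
- by move=> a x y _ _ /=; rewrite fD // gD.
- by move=> x y _ _ /=; rewrite fM // gM.
Qed.

End AlgIso.

Section Equivalence.
Context (G : groupType) (K : fieldType).

Lemma equivalent_sym (A B : nuAlgType K)
    (alpha : partial_action G A) (beta : partial_action G B) :
  equivalent alpha beta -> equivalent beta alpha.
Proof.
move=> [f [fiso fP]]; have [g [fK gK giso]] := alg_isoT_inv fiso.
have gf : g \o f = id by apply/funext.
exists g; split=> // h; have [fh _] := fP h; have [fh' fa] := fP h^-1%g.
split=> [|y]; first by rewrite -(fP h).1 image_comp gf image_id.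
rewrite -(fP h^-1%g).1 => -[x Dx <-].
by rewrite fK (fP h).2 // fK.
Qed.

Lemma equivalent_trans (A B C : nuAlgType K) (alpha : partial_action G A)
    (beta : partial_action G B) (gamma : partial_action G C) :
  equivalent alpha beta -> equivalent beta gamma -> equivalent alpha gamma.
Proof.
move=> [f [fiso fP]] [g [giso gP]]; exists (g \o f).
split=> [|h]; first exact: alg_iso_comp.
split=> [|x Dx]; first by rewrite -image_comp (fP h).1 (gP h).1.
by rewrite /= -(fP h).2 // (gP h).2 // -(fP h^-1%g).1; exists x.
Qed.

End Equivalence.

(** * Basic properties of partial actions *)

Section PartialActionTheory.
Context (G : groupType) (K : fieldType) (A : nuAlgType K).
Variable alpha : partial_action G A.
Local Notation D := (pdom alpha).
Local Notation al := (pact alpha).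
Implicit Types (g h : G) (x y : A).

Lemma pact_dom g x : D g^-1%g x -> D g (al g x).
Proof. by have [[+ _ _] _ _] := pact_iso alpha g => /[apply]. Qed.

Lemma pactDZ g (a : K) x y : D g^-1%g x -> D g^-1%g y ->
  al g (a *: x + y) = a *: al g x + al g y.
Proof. by have [_ + _] := pact_iso alpha g; apply. Qed.

Lemma pact_mul g x y : D g^-1%g x -> D g^-1%g y ->
  al g (x * y)%g = (al g x * al g y)%g.
Proof. by have [_ _] := pact_iso alpha g; apply. Qed.

Lemma pactK g x : D g^-1%g x -> al g^-1%g (al g x) = x.
Proof.
move=> Dx; rewrite pactM ?mulVg ?pact1 //.
by split=> //=; split; rewrite ?invgK; exact: pact_dom.
Qed.

Lemma pactKV g x : D g x -> al g (al g^-1%g x) = x.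
Proof. by move=> Dx; have := @pactK g^-1%g x; rewrite invgK; apply. Qed.

(** The domain axiom [pdomM] for the pair [h^-1], [g^-1], read at the point [al g x], which
    [al g^-1] sends back to [x]. *)
Lemma pact_domM g h x : D g^-1%g x -> D h x -> D (g * h)%g (al g x).
Proof.
move=> Dx Dhx; have := @pdomM _ _ _ alpha h^-1%g g^-1%g (al g x).
rewrite !invgM !invgK; apply; split=> /=; first exact: pact_dom.
by rewrite pactK.
Qed.

Lemma pdomMl g x y : D g x -> D g (x * y)%g.
Proof. by have [_ DI] := pdom_ideal alpha g => /(DI y) []. Qed.

Lemma pdomMr g x y : D g y -> D g (x * y)%g.
Proof. by have [_ DI] := pdom_ideal alpha g => /(DI x) []. Qed.

End PartialActionTheory.

(** * Global actions *)

Section GlobalActionTheory.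
Context (G : groupType) (K : fieldType) (B : nuAlgType K).
Variable beta : partial_action G B.
Hypothesis gl : is_global beta.
Local Notation be := (pact beta).
Implicit Types (g h : G) (x y : B).

Lemma global_pactDZ g (a : K) x y :
  be g (a *: x + y) = a *: be g x + be g y.
Proof. by rewrite pactDZ // gl. Qed.

Lemma global_pact_mul g x y : be g (x * y)%g = (be g x * be g y)%g.
Proof. by rewrite pact_mul // gl. Qed.

Lemma global_pactM g h x : be g (be h x) = be (g * h)%g x.
Proof. by rewrite pactM //= /preimage /= !gl. Qed.

Lemma global_pactK g : cancel (be g) (be g^-1%g).
Proof. by move=> x; rewrite pactK // gl. Qed.

Lemma global_pactKV g : cancel (be g^-1%g) (be g).
Proof. by move=> x; rewrite pactKV // gl. Qed.

Lemma global_pact0 g : be g 0 = 0.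
Proof. exact: linear_comb0 (global_pactDZ g). Qed.

End GlobalActionTheory.

Section MakeGlobalAction.
Context (G : groupType) (K : fieldType) (B : nuAlgType K) (be : G -> B -> B).
Hypothesis be1 : forall x, be 1%g x = x.
Hypothesis beM : forall g h x, be g (be h x) = be (g * h)%g x.
Hypothesis beDZ : forall g (a : K) x y,
  be g (a *: x + y) = a *: be g x + be g y.
Hypothesis be_mul : forall g x y, be g (x * y)%g = (be g x * be g y)%g.

(** Kept transparent, so that [pdom] and [pact] of the result reduce to the given data. *)
Definition global_action : partial_action G B.
Proof.
exists (fun=> [set: B]) be => //.
move=> g; split=> //; rewrite setTT_bijective; exists (be g^-1%g) => x.
  by rewrite beM mulVg be1.
by rewrite beM mulgV be1.
Defined.

End MakeGlobalAction.

(** * The canonical enveloping action inside the algebra of functions on the group *)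

Section CanonicalEnvelope.
Context (G : groupType) (K : fieldType) (A : nuAlgType K).
Variable alpha : partial_action G A.
Hypothesis alpha_unital : forall g, unital (pdom alpha g).
Local Notation D := (pdom alpha).
Local Notation al := (pact alpha).
Implicit Types (g h : G) (a b x y : A).

Definition punit g : A := projT1 (cid2 (alpha_unital g)).
Local Notation u := punit.

Lemma punit_dom g : D g (u g).
Proof. by rewrite /punit; case: cid2. Qed.

Lemma mul_punitl g x : D g x -> (u g * x)%g = x.
Proof. by rewrite /punit; case: cid2 => e /= _ eP /eP []. Qed.

Lemma mul_punitr g x : D g x -> (x * u g)%g = x.
Proof. by rewrite /punit; case: cid2 => e /= _ eP /eP []. Qed.

Lemma punitC g x : (u g * x)%g = (x * u g)%g.
Proof.
apply: ideal_unitC (pdom_ideal alpha g) (punit_dom g) _ => y Dy.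
by rewrite mul_punitl // mul_punitr.
Qed.

Lemma mul_punit1 x : (x * u 1)%g = x.
Proof. by rewrite mul_punitr // pdom1. Qed.

(* Both sides are the unit of [D g `&` D (g * h)]. *)
Lemma pact_punit g h : al g (u g^-1 * u h)%g = (u g * u (g * h))%g.
Proof.
have Du : D g^-1%g (u g^-1 * u h)%g by apply/pdomMl/punit_dom.
have Dau := pact_dom Du.
have Dau' : D (g * h)%g (al g (u g^-1 * u h)%g).
  by apply: pact_domM Du _; apply/pdomMr/punit_dom.
have Dw : D g (u g * u (g * h))%g by apply/pdomMl/punit_dom.
have Dw' : D (g * h)%g (u g * u (g * h))%g by apply/pdomMr/punit_dom.
(* The left side lies in both ideals, so multiplying it by the right side [w] leaves it unchanged.
   Pulling [w] back along [al g] shows that this product is also [w]. *)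
rewrite -[LHS](mul_punitr Dau') -[X in (X * _)%g = _](mul_punitr Dau) -mulgA.
set w := (u g * _)%g in Dw Dw' *.
have Dz : D g^-1%g (al g^-1%g w) by apply: pact_dom; rewrite invgK.
have Dz' : D h (al g^-1%g w).
  rewrite -[h](mulKg g); apply: pact_domM Dw'.
  by rewrite invgK.
rewrite -[in LHS](pactKV Dw) -pact_mul // -mulgA (mul_punitl Dz').
by rewrite (mul_punitl Dz) pactKV.
Qed.

(** Since [x = x * u g^-1], the product [x * u h] is [x * (u g^-1 * u h)], to which multiplicativity
    of [al g] and [pact_punit] apply. *)
Lemma pact_mul_punit g h x : D g^-1%g x ->
  al g (x * u h)%g = (al g x * u (g * h))%g.
Proof.
move=> Dx; rewrite -{1}(mul_punitr Dx) -mulgA pact_mul //; last first.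
  exact/pdomMl/punit_dom.
by rewrite pact_punit mulgA (mul_punitr (pact_dom Dx)).
Qed.

Definition shift (T : Type) g (f : G -> T) : G -> T := fun h => f (g^-1 * h)%g.

(** The factor [u h] projects [a] to [D h], the domain of [al h^-1]. *)
Definition orbit_fun a : G -> A := fun h => al h^-1%g (a * u h)%g.

Lemma pact_orbit_dom h a : D h^-1^-1%g (a * u h)%g.
Proof. by rewrite invgK; apply/pdomMr/punit_dom. Qed.
Hint Resolve pact_orbit_dom : core.

Lemma orbit_funDZ (c : K) a b :
  orbit_fun (c *: a + b) = c *: orbit_fun a + orbit_fun b.
Proof. by apply/funext => h; rewrite /orbit_fun mulgDZl pactDZ. Qed.

(** As [u h] is a central idempotent, [a * b * u h] is the product of [a * u h] and [b * u h]. *)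
Lemma orbit_fun_mul a b : orbit_fun (a * b)%g = (orbit_fun a * orbit_fun b)%g.
Proof.
apply/funext => h; rewrite fct_mulE /orbit_fun -pact_mul //.
congr (al _ _); rewrite -!mulgA; congr (_ * _)%g.
by rewrite mulgA punitC -mulgA mul_punitl //; exact: punit_dom.
Qed.

(** The value at 1 recovers [a]. *)
Lemma orbit_fun_inj : injective orbit_fun.
Proof.
move=> a b /(congr1 (@^~ 1%g)).
by rewrite /orbit_fun invg1 !pact1 !mul_punit1.
Qed.

(** At [h], the left side is [al (h^-1 * g) (x * u (g^-1 * h))]. By [pact_mul_punit] the right side
    is [al h^-1 (al g (x * u (g^-1 * h)))], and the composition axiom identifies the two. *)
Lemma shift_orbit_fun g x : D g^-1%g x ->
  shift g (orbit_fun x) = orbit_fun (al g x).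
Proof.
move=> Dx; apply/funext => h; rewrite /shift /orbit_fun.
rewrite -{4}[h](mulVKg g) -pact_mul_punit // pactM; last first.
  split; first exact: pdomMl.
  split; first by apply/pact_dom/pdomMl.
  rewrite invgK -[h in D h](mulVKg g).
  by apply: pact_domM; [exact: pdomMl|apply/pdomMr/punit_dom].
by rewrite invgM invgK.
Qed.

(** The extra factor [u g^-1] leaves [al (h^-1 * g)] as [u h^-1], which is absorbed by
    [orbit_fun b h], an element of [D h^-1]. *)
Lemma orbit_fun_absorb g a h b :
  (shift g (orbit_fun a) h * orbit_fun b h)%g =
  (shift g (orbit_fun (a * u g^-1)%g) h * orbit_fun b h)%g.
Proof.
rewrite /shift /orbit_fun -[(a * u g^-1 * _)%g]mulgA punitC mulgA.
rewrite (@pact_mul_punit _ g^-1%g) // invgM invgK mulgK -mulgA mul_punitl //.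
exact: pact_dom.
Qed.

Lemma orbit_fun_absorbl g a h b :
  (orbit_fun b h * shift g (orbit_fun a) h)%g =
  (orbit_fun b h * shift g (orbit_fun (a * u g^-1)%g) h)%g.
Proof.
rewrite /shift /orbit_fun -[(a * u g^-1 * _)%g]mulgA punitC mulgA.
rewrite (@pact_mul_punit _ g^-1%g) // invgM invgK mulgK.
rewrite -(punitC h^-1%g) mulgA (@mul_punitr h^-1%g) //.
exact: pact_dom.
Qed.

(** Once [a] is replaced by [a * u g^-1], which lies in [D g^-1], its translate is again an orbit
    function. This formula and its mirror image make the embedded copy of [A] an ideal. *)
Lemma shift_orbit_fun_mul g a b :
  (shift g (orbit_fun a) * orbit_fun b)%g =
  orbit_fun (al g (a * u g^-1)%g * b)%g.
Proof.
rewrite orbit_fun_mul -shift_orbit_fun; last exact/pdomMr/punit_dom.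
by apply/funext => h; exact: orbit_fun_absorb.
Qed.

Lemma orbit_fun_mul_shift g a b :
  (orbit_fun b * shift g (orbit_fun a))%g =
  orbit_fun (b * al g (a * u g^-1)%g)%g.
Proof.
rewrite orbit_fun_mul -shift_orbit_fun; last exact/pdomMr/punit_dom.
by apply/funext => h; exact: orbit_fun_absorbl.
Qed.

Definition shifted_orbits : set (G -> A) :=
  \bigcup_g (shift g @` range orbit_fun).


Lemma shiftM (T : Type) g h (f : G -> T) :
  shift g (shift h f) = shift (g * h)%g f.
Proof. by apply/funext => k; rewrite /shift invgM mulgA. Qed.

Lemma shift1 (T : Type) (f : G -> T) : shift 1%g f = f.
Proof. by apply/funext => k; rewrite /shift invg1 mul1g. Qed.

(** The functions whose translate lies in the generated subalgebra form a subalgebra, and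
    translation permutes the generators. *)
Lemma gen_shift g f :
  gen_subalg shifted_orbits f -> gen_subalg shifted_orbits (shift g f).
Proof.
move=> /asboolP Sf; apply/asboolP; move: f Sf.
have [[S0 SD] SM] := subalgebra_smallest shifted_orbits.
apply: (@smallest_sub _ _ _ [set f | smallest _ _ (shift g f)]).
  by split; [split=> //= c f1 f2; exact: SD|move=> f1 f2; exact: SM].
move=> _ [h _ [_ [a _ <-] <-]] /=; rewrite shiftM; apply: sub_gen_smallest.
by exists (g * h)%g => //; exists (orbit_fun a) => //; exists a.
Qed.

Lemma gen_orbit_fun a : gen_subalg shifted_orbits (orbit_fun a).
Proof.
apply/asboolP; apply: sub_gen_smallest; exists 1%g => //.
by exists (orbit_fun a); rewrite ?shift1 //; exists a.
Qed.

Definition envelope : nuAlgType K := generated shifted_orbits.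

Definition env_act g (f : envelope) : envelope :=
  exist _ (shift g (val f)) (gen_shift g (valP f)).

Definition env_emb a : envelope := exist _ (orbit_fun a) (gen_orbit_fun a).

Fact env_act1 f : env_act 1%g f = f.
Proof. by apply/val_inj; rewrite /= shift1. Qed.

Fact env_actM g h f : env_act g (env_act h f) = env_act (g * h)%g f.
Proof. by apply/val_inj; rewrite /= shiftM. Qed.

Fact env_actDZ g (c : K) (f1 f2 : envelope) :
  env_act g (c *: f1 + f2) = c *: env_act g f1 + env_act g f2.
Proof. exact/val_inj. Qed.

Fact env_act_mul g (f1 f2 : envelope) :
  env_act g (f1 * f2)%g = (env_act g f1 * env_act g f2)%g.
Proof. exact/val_inj. Qed.

Definition envelope_action : partial_action G envelope :=
  global_action env_act1 env_actM env_actDZ env_act_mul.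

Lemma env_emb_inj : injective env_emb.
Proof. by move=> a b /(congr1 val) /orbit_fun_inj. Qed.

Lemma env_embDZ (c : K) a b : env_emb (c *: a + b) = c *: env_emb a + env_emb b.
Proof. by apply/val_inj; rewrite /= orbit_funDZ. Qed.

Lemma env_emb_mul a b : env_emb (a * b)%g = (env_emb a * env_emb b)%g.
Proof. by apply/val_inj; rewrite /= orbit_fun_mul. Qed.

Lemma env_act_emb g x : D g^-1%g x -> env_act g (env_emb x) = env_emb (al g x).
Proof. by move=> Dx; apply/val_inj; rewrite /= shift_orbit_fun. Qed.

Lemma env_act_emb_mul g a b :
  (env_act g (env_emb a) * env_emb b)%g =
  env_emb (al g (a * u g^-1)%g * b)%g.
Proof. by apply/val_inj; rewrite /= shift_orbit_fun_mul. Qed.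

Lemma env_emb_mul_act g a b :
  (env_emb b * env_act g (env_emb a))%g =
  env_emb (b * al g (a * u g^-1)%g)%g.
Proof. by apply/val_inj; rewrite /= orbit_fun_mul_shift. Qed.

(** Generation has to be transferred from the function algebra to the subtype: a subalgebra [M] of
    the subtype has an image [N] under [val] which is a subalgebra of the function algebra. *)
Lemma envelope_generated :
  smallest (@subalgebra K envelope)
    (\bigcup_g (env_act g @` range env_emb)) = [set: envelope].
Proof.
apply/seteqP; split=> // x _ M [[[M0 MD] MM] XM].
pose N : set (G -> A) := [set f | exists2 y : envelope, M y & val y = f].
suff [y My /val_inj <-] : N (val x) by [].
have /asboolP := valP x; apply: (@smallest_sub _ _ _ N) =>
  [|_ [g _ [_ [a _ <-] <-]]].
- split; [split|].
  + by exists 0.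
  + move=> c _ _ [y My <-] [z Mz <-]; exists (c *: y + z) => //.
    exact: MD.
  + by move=> _ _ [y My <-] [z Mz <-]; exists (y * z)%g => //; exact: MM.
- exists (env_act g (env_emb a)) => //; apply: XM.
  by exists g => //; exists (env_emb a).
Qed.

Lemma env_emb_subspace : subspace (range env_emb).
Proof.
split=> [|c _ _ [a _ <-] [b _ <-]]; last first.
  by exists (c *: a + b); rewrite ?env_embDZ.
by exists 0 => //; exact: linear_comb0 env_embDZ.
Qed.

Lemma env_emb_ideal : ideal (range env_emb).
Proof.
have [R0 RD] := env_emb_subspace; split=> //.
(* The elements that multiply the image of [A] into itself from both sides form a subalgebra, so
   only generators need checking. *)
pose M : set envelope := [set f | forall a,
  range env_emb (f * env_emb a)%g /\ range env_emb (env_emb a * f)%g].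
suff MT f : M f by move=> f _ [a _ <-]; exact: MT.
apply: (@smallest_subalgebraP _ _ _ M envelope_generated).
- split; [split=> [a|c x y Mx My a]|move=> x y Mx My a].
  + by rewrite mul0g mulg0.
  + have [xa ax] := Mx a; have [ya ay] := My a.
    by rewrite mulgDZl mulgDZr; split; exact: RD.
  + have [[b _ bE] _] := My a; have [_ [c _ cE]] := Mx a.
    rewrite -mulgA [(_ * (x * y))%g]mulgA -bE -cE.
    by split; [exact: (Mx b).1|exact: (My c).2].
- move=> _ [g _ [_ [b _ <-] <-]] a; rewrite env_act_emb_mul env_emb_mul_act.
  by split; eexists.
Qed.

Lemma envelope_enveloping : enveloping alpha envelope_action.
Proof.
split=> //; exists env_emb; split.
- split; first exact: env_emb_ideal.
  split; [split|by move=> *; exact: env_embDZ|by move=> *; exact: env_emb_mul].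
  + by move=> a _; exists a.
  + by move=> a b _ _ /env_emb_inj.
  + by [].
- move=> g; apply/seteqP; split=> [_ [x Dx <-]|_ [[a _ <-] [_ [b _ <-] /= E]]].
    split; first by exists x.
    exists (env_emb (al g^-1%g x)); first by exists (al g^-1%g x).
    rewrite /= env_act_emb ?pactKV //.
    by apply: pact_dom; rewrite invgK.
  (* [u 1] is the unit of [A], so multiplying by its image fixes the common element while exhibiting
     it as the image of a point of [D g]. *)
  have := env_act_emb_mul g b (u 1); rewrite E -env_emb_mul !mul_punit1.
  move=> ->; exists (al g (b * u g^-1)%g) => //.
  exact/pact_dom/pdomMr/punit_dom.
- by move=> g x Dx; rewrite /= env_act_emb.
- exact: envelope_generated.
Qed.

End CanonicalEnvelope.

(** * Units and annihilators in an arbitrary enveloping action *)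

Section EnvelopingTheory.
Context (G : groupType) (K : fieldType) (A B : nuAlgType K).
Variables (alpha : partial_action G A) (beta : partial_action G B).
Variable phi : A -> B.
Local Notation D := (pdom alpha).
Local Notation al := (pact alpha).
Local Notation be := (pact beta).
Hypothesis gl : is_global beta.
Hypothesis phi_ideal : ideal (range phi).
Hypothesis phi_iso : alg_iso [set: A] (range phi) phi.
Hypothesis phi_dom : forall g, phi @` D g = range phi `&` be g @` range phi.
Hypothesis phi_act : forall g x, D g^-1%g x -> phi (al g x) = be g (phi x).
Hypothesis phi_gen :
  smallest (@subalgebra K B) (\bigcup_g (be g @` range phi)) = [set: B].
Variable one : A.
Hypothesis one_unit : forall x, (one * x)%g = x /\ (x * one)%g = x.
Implicit Types (g h : G) (a x y : A) (b : B).
Local Notation e := (phi one).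

Lemma emb_inj : injective phi.
Proof.
by have [[_ I _] _ _] := phi_iso => x y; apply: I; rewrite inE.
Qed.

Lemma embDZ (c : K) x y : phi (c *: x + y) = c *: phi x + phi y.
Proof. by have [_ -> //] := phi_iso. Qed.

Lemma emb_mul x y : phi (x * y)%g = (phi x * phi y)%g.
Proof. by have [_ _ -> //] := phi_iso. Qed.

Lemma emb_onel x : (e * phi x)%g = phi x.
Proof. by rewrite -emb_mul (one_unit x).1. Qed.

Lemma emb_oner x : (phi x * e)%g = phi x.
Proof. by rewrite -emb_mul (one_unit x).2. Qed.

Lemma emb_oneC b : (e * b)%g = (b * e)%g.
Proof.
apply: ideal_unitC phi_ideal _ _; first by exists one.
by move=> _ [x _ <-]; rewrite emb_onel emb_oner.
Qed.

(** Automorphisms preserve central elements. *)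
Lemma act_oneC g b : (be g e * b)%g = (b * be g e)%g.
Proof. by rewrite -[b](global_pactKV gl g) -!global_pact_mul // emb_oneC. Qed.

(* The intersection of two ideals with units [e] and [e'] has unit [e * e']. *)
Lemma emb_pdom_unit g : exists2 w, phi w = (e * be g e)%g &
  D g w /\ forall x, D g x -> (w * x)%g = x /\ (x * w)%g = x.
Proof.
have [_ phiI] := phi_ideal.
have : (range phi `&` be g @` range phi) (e * be g e)%g.
  split; first by apply: (phiI _ _ _).2; exists one.
  exists (be g^-1%g e * e)%g; first by apply: (phiI _ _ _).1; exists one.
  by rewrite global_pact_mul // global_pactKV.
rewrite -phi_dom => -[w Dw wE]; exists w => //; split=> // x Dx.
have [_ [_ [y _ <-] yE]] : (range phi `&` be g @` range phi) (phi x).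
  by rewrite -phi_dom; exists x.
split; apply: emb_inj; rewrite emb_mul wE.
  by rewrite -yE emb_oneC -mulgA yE emb_onel -yE -global_pact_mul // emb_onel.
by rewrite mulgA emb_oner -yE -global_pact_mul // emb_oner.
Qed.

Lemma pdom_unital g : unital (D g).
Proof. by have [w _ [Dw wP]] := emb_pdom_unit g; exists w. Qed.

(* A sum of finitely many of the ideals [be g @` range phi] has a unit, so
   each element of [B] has a central right unit. *)
Lemma annihilator_eq0 b : (forall g, (b * be g e)%g = 0) -> b = 0.
Proof.
move=> bN; pose N : set B := [set n | forall g, (n * be g e)%g = 0].
pose M : set B := [set x | exists v,
  [/\ forall z, (v * z)%g = (z * v)%g, (x * v)%g = x
     & forall n, N n -> (n * v)%g = 0]].
suff [v [_ <- Nv]] : M b by exact: Nv.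
apply: (@smallest_subalgebraP _ _ _ M phi_gen).
- split; [split=> [|c x y [v [vC xv Nv]] [w [wC yw Nw]]]|].
  + by exists 0; split=> [z||n _]; rewrite ?mul0g ?mulg0.
  + exists (v + w - (v * w)%g); split=> [z||n Nn].
    * rewrite !mulgDl !mulgDr mulNg mulgN (vC z) (wC z) -[(v * w * z)%g]mulgA.
      by rewrite (wC z) [(v * (z * w))%g]mulgA (vC z) mulgA.
    * rewrite mulgDZl !mulgDr !mulgN [(x * (v * w))%g]mulgA xv addrK.
      by rewrite (vC w) [(y * (w * v))%g]mulgA yw addrAC subrr add0r.
    * by rewrite !mulgDr mulgN mulgA Nv // Nw // mul0g oppr0 !addr0.
  + move=> x y _ [w [wC yw Nw]]; exists w; split=> //.
    by rewrite -mulgA yw.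
- move=> _ [g _ [_ [x _ <-] <-]]; exists (be g e); split=> // [z|].
    exact: act_oneC.
  by rewrite -global_pact_mul // emb_oner.
Qed.

Lemma coef_ex b h : exists a, phi a = (be h^-1%g b * e)%g.
Proof.
have [_ phiI] := phi_ideal.
have Re : range phi e by exists one.
by have [a _ aE] := (phiI (be h^-1%g b) e Re).1; exists a.
Qed.

Definition coef b : G -> A := fun h => projT1 (cid (coef_ex b h)).

Lemma coefE b h : phi (coef b h) = (be h^-1%g b * e)%g.
Proof. by rewrite /coef; case: cid. Qed.

Lemma coefDZ (c : K) b1 b2 : coef (c *: b1 + b2) = c *: coef b1 + coef b2.
Proof.
apply/funext => h; apply: emb_inj.
by rewrite coefE embDZ !coefE global_pactDZ // mulgDZl.
Qed.

Lemma coef_mul b1 b2 : coef (b1 * b2)%g = (coef b1 * coef b2)%g.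
Proof.
apply/funext => h; apply: emb_inj; rewrite fct_mulE emb_mul !coefE.
rewrite global_pact_mul // -!mulgA; congr (_ * _)%g.
by rewrite [in RHS]mulgA emb_oneC -mulgA emb_onel.
Qed.

Lemma coef_inj : injective coef.
Proof.
move=> b1 b2 E; apply/eqP; rewrite -subr_eq0; apply/eqP.
apply: annihilator_eq0 => g; apply: (can_inj (global_pactKV gl g)).
rewrite global_pact_mul // global_pactK // global_pact0 //.
rewrite -coefE addrC -scaleN1r coefDZ E scaleN1r addNr.
exact: linear_comb0 embDZ.
Qed.

Lemma coef_act g b : coef (be g b) = shift g (coef b).
Proof.
apply/funext => h; apply: emb_inj; rewrite /shift !coefE.
by rewrite global_pactM // invgM invgK.
Qed.

Hypothesis alpha_unital : forall g, unital (D g).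

Lemma emb_punit g : phi (punit alpha_unital g) = (e * be g e)%g.
Proof.
have [w <- [Dw wP]] := emb_pdom_unit g; congr (phi _).
by rewrite -[RHS](mul_punitl alpha_unital Dw) (wP _ (punit_dom _ _)).2.
Qed.

Lemma coef_emb a : coef (phi a) = orbit_fun alpha_unital a.
Proof.
apply/funext => h; apply: emb_inj; rewrite coefE phi_act; last first.
  by rewrite invgK; apply/pdomMr/punit_dom.
rewrite emb_mul emb_punit mulgA emb_oner global_pact_mul //.
by rewrite global_pactK.
Qed.

Local Notation S := (shifted_orbits alpha_unital).

Lemma coef_gen b : gen_subalg S (coef b).
Proof.
have [[S0 SD] SM] := subalgebra_smallest S.
pose M : set B := [set b | smallest (@subalgebra K _) S (coef b)].
apply/asboolP; move: b.
apply: (@smallest_subalgebraP _ _ _ M phi_gen).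
- split; [split=> [|c x y Mx My]|move=> x y Mx My]; rewrite /M /=.
  + by rewrite (linear_comb0 coefDZ).
  + by rewrite coefDZ; exact: SD.
  + by rewrite coef_mul; exact: SM.
- move=> _ [g _ [_ [a _ <-] <-]]; rewrite /M /= coef_act coef_emb.
  by apply: sub_gen_smallest; exists g => //; exists (orbit_fun alpha_unital a).
Qed.

Definition to_envelope b : envelope alpha_unital :=
  exist _ (coef b) (coef_gen b).

Lemma to_envelope_surj f : exists b, to_envelope b = f.
Proof.
pose M : set (envelope alpha_unital) := range to_envelope.
suff [b _ <-] : M f by exists b.
apply: (@smallest_subalgebraP _ _ _ M (envelope_generated alpha_unital)).
- split; [split|].
  + by exists 0 => //; apply/val_inj; rewrite /= (linear_comb0 coefDZ).
  + move=> c _ _ [x _ <-] [y _ <-]; exists (c *: x + y) => //.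
    by apply/val_inj; rewrite /= coefDZ.
  + move=> _ _ [x _ <-] [y _ <-]; exists (x * y)%g => //.
    by apply/val_inj; rewrite /= coef_mul.
- move=> _ [g _ [_ [a _ <-] <-]]; exists (be g (phi a)) => //.
  by apply/val_inj; rewrite /= coef_act coef_emb.
Qed.

Lemma equivalent_envelope : equivalent beta (envelope_action alpha_unital).
Proof.
exists to_envelope; split.
  split.
  - split=> //.
    + by move=> x y _ _ /(congr1 val) /coef_inj.
    + by move=> f _; have [b <-] := to_envelope_surj f; exists b.
  - by move=> c x y _ _; apply/val_inj; rewrite /= coefDZ.
  - by move=> x y _ _; apply/val_inj; rewrite /= coef_mul.
move=> g; split=> [|b _]; last by apply/val_inj; rewrite /= coef_act.
rewrite gl; apply/seteqP; split=> // f _.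
by have [b <-] := to_envelope_surj f; exists b.
Qed.

End EnvelopingTheory.

Theorem theorem4p5 (K : fieldType) (A : nuAlgType K) (G : groupType)
    (alpha : partial_action G A) (hA : unital [set: A]) :
  ((exists (B : nuAlgType K) (beta : partial_action G B),
      enveloping alpha beta) <->
   (forall g : G, unital (pdom alpha g))) /\
  (forall (B B' : nuAlgType K)
      (beta : partial_action G B) (beta' : partial_action G B'),
      enveloping alpha beta -> enveloping alpha beta' ->
      equivalent beta beta').
Proof.
have [one _ oneP] := hA.
have one_unit x : (one * x)%g = x /\ (x * one)%g = x by exact: oneP.
have unitalP B (beta : partial_action G B) :
    enveloping alpha beta -> forall g, unital (pdom alpha g).
  move=> [gl [phi [[phi_ideal phi_iso] phi_dom phi_act phi_gen]]].
  exact: pdom_unital gl phi_ideal phi_iso phi_dom _ one_unit.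
split; first split=> [[B [beta]]|alpha_unital].
- exact: unitalP.
- exists (envelope alpha_unital), (envelope_action alpha_unital).
  exact: envelope_enveloping.
move=> B B' beta beta' E E'; pose alpha_unital := unitalP _ _ E.
have equivE C (gamma : partial_action G C) : enveloping alpha gamma ->
    equivalent gamma (envelope_action alpha_unital).
  move=> [gl [phi [[phi_ideal phi_iso] phi_dom phi_act phi_gen]]].
  exact: (equivalent_envelope gl phi_ideal phi_iso phi_dom phi_act phi_gen
           one_unit).
by apply: equivalent_trans (equivE _ _ E) _; apply/equivalent_sym/equivE.
Qed.
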